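(* Let $B$ be a right-alternative superalgebra, let $Z=Z(B)_0$ be the even part of its center, suppose that $Z$ contains no zero divisors of $B$, and let $F=Z^{-1}Z$. Suppose that $B$ is a central order in one of the superalgebras $B_{4|4}(w)$, $B_{n|n}$, $B_{2|2}(\nu)$ over $F$, i.e. that $Z^{-1}B$ is isomorphic, as a $\mathbb{Z}_2$-graded $F$-algebra, to $B_{4|4}(w)$ for some $w\in M_2(F)$ with $\mathrm{tr}(w)\neq 0$, or to $B_{n|n}$ for some positive integer $n$, or to $B_{2|2}(\nu)$ for some $\nu\in F$. Then $B$ embeds, as a $Z$-module, in a finitely generated $Z$-module.
   Context: Algebras are not assumed associative; $(x,y,z)=(xy)z-x(yz)$, $[x,y]=xy-yx$. A $\mathbb{Z}_2$-graded algebra $B=A+M$ (with $A$ the even part, $M$ the odd part, $A^2+M^2\subseteq A$, $AM+MA\subseteq M$) is a right-alternative superalgebra if for all homogeneous $x,y,z\in A\cup M$ $$(x,y,z)+(-1)^{|z||y|}(x,z,y)=0,$$ where $|a|=0$ for $a\in A$ and $|a|=1$ for $a\in M$. The center is $Z(B)=\{z\in B\mid (z,x,y)=(x,z,y)=(x,y,z)=[x,z]=0\ \ \forall x,y\in B\}$, and $Z(B)_0=Z(B)\cap A$ is its even part. Central order: let $B$ be a $\mathbb{Z}_2$-graded algebra such that $Z=Z(B)_0$ contains no zero divisors of the entire algebra $B$. Let $Z^{-1}B$ be the $\mathbb{Z}_2$-graded algebra of fractions $\frac{b}{z}$, $b\in B$, $0\ne z\in Z$ (classes of pairs under $(a,x)\sim(b,y)\iff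 ay=bx$, with the usual operations on fractions), considered over the field of fractions $Z^{-1}Z$. Then $B$ is called a central order in $Z^{-1}B$. Let $F$ be a field. In each of the following, $[V]$ denotes a vector space isomorphic to $V$ via $x\mapsto[x]$; the first summand is the even part and the second the odd part. $B_{n|n}=F^n+[F^n]$, where $F^n$ is the direct sum of $n$ copies of $F$ with componentwise product $xy$, with multiplication $$x\cdot y=xy,\quad [x]\cdot[y]=xy,\quad x\cdot[y]=[xy],\quad [x]\cdot y=[x\,\tau(y)],$$ for $x,y\in F^n$, where $\tau(a_1,\dots,a_n)=(a_2,\dots,a_n,a_1)$. $B_{2|2}(\nu)=F^2+[F^2]$, $\nu\in F$, with multiplication $$x\cdot y=xy,\quad [x]\cdot[y]=x\,\chi(y),\quad x\cdot[y]=[xy],\quad [x]\cdot y=[xy^{*}],$$ for $x,y\in F^2$, where $xy$ is the componentwise product, $(a_1,a_2)^*=(a_2,a_1)$ and $\chi(a_1,a_2)=(a_1+a_2,\,a_1+\nu a_2)$. $B_{4|4}(w)=M_2(F)+[M_2(F)]$, where $w\in M_2(F)$ is a fixed matrix with $\mathrm{tr}(w)\ne0$, with multiplication $$x\cdot y=xy,\quad [x]\cdot[y]=\frac{\mathrm{tr}(y)}{\mathrm{tr}(w)}\,x,\quad [x]\cdot y=[x\overline{y}],\quad x\cdot[y]=\bigl[xy-([x][y])^{D}\bigr],$$ for $x,y\in M_2(F)$, where $xy$ is the matrix product, $a^{D}=aw-wa$, and $\overline{a}=\mathrm{tr}(a)1-a$ is the symplectic involution of $M_2(F)$. *)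

(* Defs.v *)
From HB Require Import structures.
From mathcomp Require Import all_boot all_order all_algebra.
From mathcomp Require Import boolp ring.

Set Implicit Arguments.
Unset Strict Implicit.
Unset Printing Implicit Defensive.

Import GRing.Theory.
Local Open Scope ring_scope.
Local Open Scope quotient_scope.

(* A Z_2-graded algebra over K, neither associative nor unital in general.
   [gpart false] is the even part and [gpart true] the odd part. *)
Record gralg (K : comNzRingType) := GrAlg {
  gcar :> lmodType K;
  gmul : gcar -> gcar -> gcar;
  gpart : bool -> gcar -> Prop;
  gmul_linear_l : forall y, linear (fun x => gmul x y);
  gmul_linear_r : forall x, linear (gmul x);
  gpart0 : forall i, gpart i 0;
  gpartP : forall i a x y, gpart i x -> gpart i y -> gpart i (a *: x + y);
  gpart_span : forall x,
    exists x0 x1, [/\ gpart false x0, gpart true x1 & x = x0 + x1];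
  gpart_direct : forall x, gpart false x -> gpart true x -> x = 0;
  gpart_mul : forall i j x y,
    gpart i x -> gpart j y -> gpart (i (+) j) (gmul x y)
}.

Definition gr_iso (K : comNzRingType) (S T : gralg K) : Prop :=
  exists f : {linear S -> T},
    [/\ bijective f,
        forall x y, f (gmul x y) = gmul (f x) (f y)
      & forall i x, gpart i x <-> gpart i (f x)].

Section Gralg.
Variables (K : comNzRingType) (B : gralg K).
Implicit Types x y z : B.

Definition associator x y z : B := gmul (gmul x y) z - gmul x (gmul y z).
Definition commutator x y : B := gmul x y - gmul y x.

Definition right_alternative_super : Prop :=
  forall (i j k : bool) x y z, gpart i x -> gpart j y -> gpart k z ->
    associator x y z + (-1) ^+ (k * j) *: associator x z y = 0.

Definition center z : Prop := forall x y,
  [/\ associator z x y = 0, associator x z y = 0, associator x y z = 0 & commutator x z = 0].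

Definition zero_divisor z : Prop :=
  z <> 0 /\ exists b, b <> 0 /\ (gmul z b = 0 \/ gmul b z = 0).

Lemma gmulDl x y z : gmul (x + y) z = gmul x z + gmul y z.
Proof. by have := gmul_linear_l z 1 x y; rewrite !scale1r. Qed.
Lemma gmulDr x y z : gmul z (x + y) = gmul z x + gmul z y.
Proof. by have := gmul_linear_r z 1 x y; rewrite !scale1r. Qed.
Lemma gmul0l z : gmul 0 z = 0.
Proof. by apply: (addrI (gmul 0 z)); rewrite -gmulDl !addr0. Qed.
Lemma gmul0r z : gmul z 0 = 0.
Proof. by apply: (addrI (gmul z 0)); rewrite -gmulDr !addr0. Qed.
Lemma gmulZl a x z : gmul (a *: x) z = a *: gmul x z.
Proof. by have := gmul_linear_l z a x 0; rewrite gmul0l !addr0. Qed.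
Lemma gmulZr a x z : gmul z (a *: x) = a *: gmul z x.
Proof. by have := gmul_linear_r z a x 0; rewrite gmul0r !addr0. Qed.

Definition even_center : {pred B} := fun z => `[< gpart false z /\ center z >].

Lemma centerE z : center z <-> forall x y,
  [/\ gmul (gmul z x) y = gmul z (gmul x y),
      gmul (gmul x z) y = gmul x (gmul z y),
      gmul (gmul x y) z = gmul x (gmul y z) & gmul x z = gmul z x].
Proof.
rewrite /center /associator /commutator; split=> h x y; have [h1 h2 h3 h4] := h x y.
  by split; apply/eqP; rewrite -subr_eq0; apply/eqP.
by split; apply/eqP; rewrite subr_eq0; apply/eqP.
Qed.

Lemma even_center_submod : submod_closed even_center.
Proof.
split=> [|a u v /asboolP[eu /centerE cu] /asboolP[ev /centerE cv]].
  apply/asboolP; split; first exact: gpart0.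
  by apply/centerE => x y; rewrite !(gmul0l, gmul0r).
apply/asboolP; split; first exact: gpartP.
apply/centerE => x y; have [u1 u2 u3 u4] := cu x y; have [v1 v2 v3 v4] := cv x y.
split; rewrite !(gmulDl, gmulDr, gmulZl, gmulZr).
- by rewrite u1 v1.
- by rewrite u2 v2.
- by rewrite u3 v3.
- by rewrite u4 v4.
Qed.

HB.instance Definition _ :=
  GRing.isSubmodClosed.Build K B even_center even_center_submod.

Record evenCenter := EvenCenter { ec_val :> B; _ : ec_val \in even_center }.
HB.instance Definition _ := [isSub for ec_val].
HB.instance Definition _ := [Choice of evenCenter by <:].
HB.instance Definition _ := [SubChoice_isSubLmodule of evenCenter by <:].

Implicit Types u v w : evenCenter.

Lemma ec_center u : center u. Proof. by case: u => u /= /asboolP[]. Qed.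
Lemma ecA1 u x y : gmul (gmul u x) y = gmul u (gmul x y).
Proof. by have /centerE/(_ x y)[] := ec_center u. Qed.
Lemma ecA2 u x y : gmul (gmul x u) y = gmul x (gmul u y).
Proof. by have /centerE/(_ x y)[] := ec_center u. Qed.
Lemma ecC u x : gmul x u = gmul u x.
Proof. by have /centerE/(_ x x)[] := ec_center u. Qed.
Lemma ecA3 u x y : gmul x (gmul u y) = gmul u (gmul x y).
Proof. by rewrite -ecA2 ecC ecA1. Qed.

Lemma ecmul_subproof u v : gmul u v \in even_center.
Proof.
apply/asboolP; split.
  case: u v => [u /= /asboolP[eu _]] [v /= /asboolP[ev _]].
  exact: (gpart_mul eu ev).
apply/centerE => x y; split.
- by rewrite (ecA1 u v x) (ecA1 u _ y) (ecA1 v x y) (ecA1 u v).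
- by rewrite (ecA3 u x v) (ecA1 u _ y) (ecA2 v x y) (ecA1 u v y) (ecA3 u x).
- by rewrite (ecA3 u _ v) (ecC v) (ecA3 u y v) (ecA3 u x) (ecC v y) (ecA3 v x).
- by rewrite (ecA3 u x v) (ecC v x) (ecA1 u v x).
Qed.

Definition ecmul u v : evenCenter := EvenCenter (ecmul_subproof u v).

Lemma ecmulC : commutative ecmul.
Proof. by move=> u v; apply: val_inj; exact: ecC. Qed.

Lemma ecmulA u v w : ecmul (ecmul u v) w = ecmul u (ecmul v w).
Proof. by apply: val_inj; exact: ecA1. Qed.

Lemma ecmul_linear_r u : linear (ecmul u).
Proof. by move=> a v w; apply: val_inj; exact: gmul_linear_r. Qed.

Lemma ecmul_linear_l v : linear (fun u => ecmul u v).
Proof. by move=> a u w; apply: val_inj; exact: gmul_linear_l. Qed.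

(* Z is nonzero (so that Z^-1 Z exists and is a field) and contains no zero
   divisors of the entire algebra B. *)
Definition regular_even_center : Prop :=
  (exists z : evenCenter, z <> 0) /\
  (forall z : evenCenter, ~ zero_divisor z).

Lemma regular_ecmul0 (h : regular_even_center) u (b : B) :
  u != 0 -> gmul u b = 0 -> b = 0.
Proof.
case: h => _ h u0 ub; apply: contrapT => b0; apply: (h u); split.
  by move=> e; case/eqP: u0; apply: val_inj.
by exists b; split => //; left.
Qed.

(* A module over the K-algebra Z of even central elements.  As Z need not contain a
   unit, the K-module structure and compatibility are part of the data, and
   unitality is the separate condition [zunital]. *)
Record centerModule := ZModule {
  zcar :> lmodType K;
  zact : evenCenter -> zcar -> zcar;
  zact_linear_l : forall n, linear (fun u => zact u n);
  zact_linear_r : forall u, linear (zact u);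
  zactA : forall u v n, zact (ecmul u v) n = zact u (zact v n)
}.

Definition zunital (N : centerModule) : Prop :=
  forall e : evenCenter, (forall u, ecmul e u = u) -> forall n : N, zact e n = n.

(* The submodule generated by v_1, ..., v_k is the sum of the K v_i + Z v_i; the
   first terms are redundant when Z contains a unit acting as the identity. *)
Definition zfingen (N : centerModule) : Prop :=
  exists (k : nat) (v : 'I_k -> N), forall n : N,
    exists (c : 'I_k -> K) (u : 'I_k -> evenCenter),
      n = \sum_i (c i *: v i + zact (u i) (v i)).

Definition zembeds (M N : centerModule) : Prop :=
  exists f : {linear M -> N},
    injective f /\ forall u m, f (zact u m) = zact u (f m).

Definition center_centerModule : centerModule :=
  @ZModule _ ecmul ecmul_linear_l ecmul_linear_r ecmulA.

Lemma alg_zact_linear_l (b : B) : linear (fun u : evenCenter => gmul u b).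
Proof. by move=> a u v; exact: gmul_linear_l. Qed.

Definition alg_centerModule : centerModule :=
  @ZModule B (fun u b => gmul u b) alg_zact_linear_l
    (fun u => @gmul_linear_r _ B u) ecA1.

Definition torsion_free (N : centerModule) : Prop :=
  forall u (n : N), u != 0 -> zact u n = 0 -> n = 0.

Lemma alg_torsion_free (h : regular_even_center) : torsion_free alg_centerModule.
Proof. by move=> u n; exact: regular_ecmul0. Qed.

Lemma center_torsion_free (h : regular_even_center) :
  torsion_free center_centerModule.
Proof.
by move=> u v u0 /(congr1 val) /(regular_ecmul0 h u0) e; exact: val_inj.
Qed.

End Gralg.

Section ZAct.
Variables (K : comNzRingType) (B : gralg K) (N : centerModule B).
Implicit Types (u v : evenCenter B) (n m : N).

Lemma zactDl u v n : zact (u + v) n = zact u n + zact v n.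
Proof. by have := zact_linear_l n 1 u v; rewrite !scale1r. Qed.
Lemma zactDr u n m : zact u (n + m) = zact u n + zact u m.
Proof. by have := zact_linear_r u 1 n m; rewrite !scale1r. Qed.
Lemma zact0l n : zact 0 n = 0.
Proof. by apply: (addrI (zact 0 n)); rewrite -zactDl !addr0. Qed.
Lemma zact0r u : zact u (0 : N) = 0.
Proof. by apply: (addrI (zact u 0)); rewrite -zactDr !addr0. Qed.
Lemma zactNr u n : zact u (- n) = - zact u n.
Proof. by apply: (addrI (zact u n)); rewrite -zactDr !subrr zact0r. Qed.
Lemma zactC u v n : zact u (zact v n) = zact v (zact u n).
Proof. by rewrite -!zactA ecmulC. Qed.

Lemma zactI (tf : torsion_free N) u n m :
  u != 0 -> zact u n = zact u m -> n = m.
Proof.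
move=> u0 e; apply/eqP; rewrite -subr_eq0; apply/eqP.
by apply: (tf u) => //; rewrite zactDr zactNr e subrr.
Qed.
End ZAct.

(* For a torsion-free Z-module N, Z^-1 N is the set of classes of pairs (n, z)
   with z nonzero in Z, where (n, z) ~ (m, w) iff w n = z m. *)
Section Fractions.
Variables (K : comNzRingType) (B : gralg K) (hB : regular_even_center B).
Variables (N : centerModule B) (tf : torsion_free N).

Definition denom := {z : evenCenter B | z != 0}.

Definition frac_equiv (p q : N * denom) : bool :=
  zact (val q.2) p.1 == zact (val p.2) q.1.

Lemma frac_refl : reflexive frac_equiv.
Proof. by move=> p; exact: eqxx. Qed.
Lemma frac_sym : symmetric frac_equiv.
Proof. by move=> p q; rewrite /frac_equiv eq_sym. Qed.
Lemma frac_trans : transitive frac_equiv.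
Proof.
move=> [m [v v0]] [n [u u0]] [k [w w0]]; rewrite /frac_equiv /= => /eqP e1 /eqP e2.
apply/eqP; apply: (zactI tf v0).
by rewrite zactC e1 zactC e2 zactC.
Qed.

Canonical frac_equivRel := EquivRel frac_equiv frac_refl frac_sym frac_trans.

(* The unused argument lets canonical inference recover hB from the type: it is
   needed to multiply denominators. *)
Definition fractions_of (_ : regular_even_center B) := {eq_quot frac_equivRel}.
Definition fractions := fractions_of hB.
HB.instance Definition _ : EqQuotient _ frac_equivRel fractions :=
  EqQuotient.on fractions.
HB.instance Definition _ := Choice.on fractions.

Definition mkfrac (n : N) (z : denom) : fractions := \pi_fractions (n, z).

Lemma mkfracP n z m w :
  mkfrac n z = mkfrac m w <-> zact (val w) n = zact (val z) m.
Proof. by split=> [/eqmodP /eqP|e]; last exact/eqmodP/eqP. Qed.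

Lemma fracE (p : fractions) : p = mkfrac (repr p).1 (repr p).2.
Proof. by rewrite /mkfrac -surjective_pairing reprK. Qed.

Lemma fracW (P : fractions -> Prop) : (forall n z, P (mkfrac n z)) -> forall p, P p.
Proof. by move=> h p; rewrite [p]fracE. Qed.

Lemma denommul_subproof (z w : denom) : ecmul (val z) (val w) != 0.
Proof.
apply/eqP => e; have /eqP := valP w; apply.
exact: (center_torsion_free hB (valP z) e).
Qed.
Definition denommul (z w : denom) : denom :=
  exist (fun z => is_true (z != 0)) _ (denommul_subproof z w).

Lemma denom_exists : exists z : evenCenter B, z != 0.
Proof. by case: hB => -[z z0] _; exists z; apply/eqP. Qed.
Definition denom0 : denom :=
  exist (fun z => is_true (z != 0)) _ (xchooseP denom_exists).

Definition fracadd (p q : fractions) : fractions :=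
  let: (n, z) := repr p in let: (m, w) := repr q in
  mkfrac (zact (val w) n + zact (val z) m) (denommul z w).
Definition fracopp (p : fractions) : fractions :=
  let: (n, z) := repr p in mkfrac (- n) z.
Definition frac0 : fractions := mkfrac 0 denom0.

Lemma fracaddE n z m w : fracadd (mkfrac n z) (mkfrac m w) =
  mkfrac (zact (val w) n + zact (val z) m) (denommul z w).
Proof.
rewrite /fracadd.
case ep: (repr (mkfrac n z)) (fracE (mkfrac n z)) => [n' z'] /= /mkfracP e1.
case eq: (repr (mkfrac m w)) (fracE (mkfrac m w)) => [m' w'] /= /mkfracP e2.
apply/mkfracP; rewrite /= !zactDr !zactA; congr (_ + _).
  rewrite (zactC (val z) (val w)) (zactC (val z) (val w')) -e1.
  by rewrite (zactC (val w') (val w)) !(zactC (val z')).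
rewrite (zactC (val w) (val z') m') -e2 (zactC (val w') (val z) m).
exact: zactC.
Qed.

Lemma fracoppE n z : fracopp (mkfrac n z) = mkfrac (- n) z.
Proof.
rewrite /fracopp.
case ep: (repr (mkfrac n z)) (fracE (mkfrac n z)) => [n' z'] /= /mkfracP e1.
by apply/mkfracP; rewrite !zactNr e1.
Qed.

Lemma frac0E z : frac0 = mkfrac 0 z.
Proof. by apply/mkfracP; rewrite !zact0r. Qed.

Lemma fracaddA : associative fracadd.
Proof.
elim/fracW=> n z; elim/fracW=> m w; elim/fracW=> k x; rewrite !fracaddE.
congr mkfrac; last by apply: val_inj; rewrite /= ecmulA.
rewrite /= !zactDr !zactA addrA.
by rewrite (zactC (val x) (val w)) (zactC (val x) (val z)).
Qed.

Lemma fracaddC : commutative fracadd.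
Proof.
elim/fracW=> n z; elim/fracW=> m w; rewrite !fracaddE addrC.
by congr mkfrac; apply: val_inj; rewrite /= ecmulC.
Qed.

Lemma frac0add : left_id frac0 fracadd.
Proof.
elim/fracW=> n z; rewrite fracaddE zact0r add0r.
by apply/mkfracP; rewrite /= zactA zactC.
Qed.

Lemma fracaddN : left_inverse frac0 fracopp fracadd.
Proof.
elim/fracW=> n z; rewrite fracoppE fracaddE zactNr addNr.
by rewrite (frac0E (denommul z z)).
Qed.

HB.instance Definition _ :=
  GRing.isZmodule.Build fractions fracaddA fracaddC frac0add fracaddN.

Lemma mkfrac0 z : mkfrac 0 z = 0.
Proof. by rewrite -(frac0E z). Qed.

Lemma mkfracD n z m w : mkfrac n z + mkfrac m w =
  mkfrac (zact (val w) n + zact (val z) m) (denommul z w).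
Proof. exact: fracaddE. Qed.

Lemma mkfrac_eq0 n z : mkfrac n z = 0 <-> n = 0.
Proof.
split=> [|->]; last exact: mkfrac0.
rewrite -(mkfrac0 z) => /mkfracP; rewrite zact0r; exact: tf (valP z).
Qed.

Lemma mkfracDl n m z : mkfrac (n + m) z = mkfrac n z + mkfrac m z.
Proof.
by rewrite mkfracD; apply/mkfracP; rewrite /= -zactDr zactA.
Qed.

Lemma mkfrac_cancel n z w : mkfrac (zact (val w) n) (denommul z w) = mkfrac n z.
Proof. by apply/mkfracP; rewrite /= zactA. Qed.

Lemma common_denom (p q : fractions) :
  exists n m z, p = mkfrac n z /\ q = mkfrac m z.
Proof.
elim/fracW: p => n z; elim/fracW: q => m w.
exists (zact (val w) n), (zact (val z) m), (denommul z w).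
rewrite mkfrac_cancel; split=> //.
by apply/mkfracP; rewrite /= zactA zactC.
Qed.
End Fractions.

Section FractionField.
Variables (K : comNzRingType) (B : gralg K) (hB : regular_even_center B).

(* Z^-1 Z *)
Definition fracfield := fractions hB (center_torsion_free hB).
HB.instance Definition _ := GRing.Zmodule.on fracfield.

Local Notation mk := (mkfrac hB (center_torsion_free hB)).

Section Scale.
Variables (N : centerModule B) (tf : torsion_free N).

Definition fracscale (a : fracfield) (p : fractions hB tf) : fractions hB tf :=
  let: (u, z) := repr a in let: (n, w) := repr p in
  mkfrac hB tf (zact u n) (denommul hB z w).

Lemma fracscaleE u z n w : fracscale (mk u z) (mkfrac hB tf n w) =
  mkfrac hB tf (zact u n) (denommul hB z w).
Proof.
rewrite /fracscale.
case: (repr (mk u z)) (fracE (mk u z)) => [u' z'] /= /mkfracP /= e1.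
case: (repr (mkfrac hB tf n w)) (fracE (mkfrac hB tf n w)) =>
  [n' w'] /= /mkfracP e2.
apply/mkfracP; rewrite /= !zactA.
rewrite (zactC (val w) u' n') -e2 -zactA -e1 zactA.
by rewrite (zactC u).
Qed.

Lemma fracscaleDr : right_distributive fracscale +%R.
Proof.
elim/fracW=> u z p q; have [n [m [w [-> ->]]]] := common_denom p q.
by rewrite -mkfracDl !fracscaleE zactDr mkfracDl.
Qed.

Lemma fracscaleDl p : {morph fracscale^~ p : a b / a + b}.
Proof.
move=> a b; have [u [v [z [-> ->]]]] := common_denom a b.
elim/fracW: p => n w.
by rewrite -mkfracDl !fracscaleE zactDl mkfracDl.
Qed.
End Scale.

Definition fracmul : fracfield -> fracfield -> fracfield :=
  @fracscale _ (center_torsion_free hB).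

Lemma fracmulE u z v w : fracmul (mk u z) (mk v w) =
  mk (ecmul u v) (denommul hB z w).
Proof. exact: fracscaleE. Qed.

Lemma fracscaleA (N : centerModule B) (tf : torsion_free N) a b
    (p : fractions hB tf) :
  fracscale a (fracscale b p) = fracscale (fracmul a b) p.
Proof.
elim/fracW: a => u z; elim/fracW: b => v w; elim/fracW: p => n x.
rewrite fracmulE !fracscaleE zactA.
by congr mkfrac; apply: val_inj; rewrite /= ecmulA.
Qed.

Lemma fracmulC : commutative fracmul.
Proof.
elim/fracW=> u z; elim/fracW=> v w; rewrite !fracmulE ecmulC.
by congr mkfrac; apply: val_inj; rewrite /= ecmulC.
Qed.

Lemma fracmulA : associative fracmul.
Proof. by move=> a b c; exact: fracscaleA. Qed.

Definition frac1 : fracfield := mk (val (denom0 hB)) (denom0 hB).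

Lemma frac1E z : frac1 = mk (val z) z.
Proof. by apply/mkfracP; rewrite /= ecmulC. Qed.

Lemma frac1scale (N : centerModule B) (tf : torsion_free N) :
  left_id frac1 (@fracscale N tf).
Proof.
elim/fracW=> n w; rewrite fracscaleE.
by apply/mkfracP; rewrite /= zactA zactC.
Qed.

Lemma frac1_neq0 : frac1 != 0.
Proof.
apply/eqP => /mkfrac_eq0 e.
by have := valP (denom0 hB); rewrite e eqxx.
Qed.

Lemma fracmulDl : left_distributive fracmul +%R.
Proof. by move=> a b p; exact: fracscaleDl. Qed.

HB.instance Definition _ := GRing.Zmodule_isComNzRing.Build fracfield
  fracmulA fracmulC (@frac1scale _ (center_torsion_free hB))
  fracmulDl frac1_neq0.

Definition fracinv (p : fracfield) : fracfield :=
  let: (u, z) := repr p in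
  if insub u is Some u' then mk (val z) u' else 0.

Lemma fracmulV (p : fracfield) : p != 0 -> fracinv p * p = 1.
Proof.
have ep := @fracE _ _ hB _ (center_torsion_free hB) p.
rewrite /fracinv; move: ep; case: (repr _) => u z /= ep p0.
case: insubP => [u' _ eu|]; last first.
  by rewrite negbK => /eqP u0; move: p0; rewrite ep u0 mkfrac0 eqxx.
rewrite ep [LHS]fracmulE [RHS](frac1E (denommul hB u' z)).
by apply/mkfracP; rewrite /= -eu; congr ecmul; exact: ecmulC.
Qed.

Lemma fracinv0 : fracinv 0 = 0.
Proof.
have e0 := @fracE _ _ hB _ (center_torsion_free hB) (0 : fracfield).
rewrite /fracinv; move: e0; case: (repr _) => u z /= /esym /mkfrac_eq0 ->.
by case: insubP => //= u'; rewrite eqxx.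
Qed.

HB.instance Definition _ :=
  GRing.ComNzRing_isField.Build fracfield fracmulV fracinv0.

Section ScaleInstance.
Variables (N : centerModule B) (tf : torsion_free N).
HB.instance Definition _ := GRing.Zmodule_isLmodule.Build fracfield
  (fractions hB tf) (@fracscaleA N tf) (@frac1scale N tf) (@fracscaleDr N tf)
  (@fracscaleDl N tf).
End ScaleInstance.

(* Z^-1 B, as a Z_2-graded algebra over Z^-1 Z *)
Definition algfrac := fractions hB (alg_torsion_free hB).
HB.instance Definition _ := GRing.Lmodule.on algfrac.

Local Notation mkB := (mkfrac hB (alg_torsion_free hB)).

Definition algfrac_mul (p q : algfrac) : algfrac :=
  let: (b, z) := repr p in let: (c, w) := repr q in
  mkB (gmul b c) (denommul hB z w).

Definition algfrac_part (i : bool) (p : algfrac) : Prop :=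
  exists (b : B) z, gpart i b /\ p = mkB b z.

Lemma algfrac_mulE (b c : B) z w :
  algfrac_mul (mkB b z) (mkB c w) = mkB (gmul b c) (denommul hB z w).
Proof.
rewrite /algfrac_mul.
case: (repr (mkB b z)) (fracE (mkB b z)) => [b' z'] /= /mkfracP /= e1.
case: (repr (mkB c w)) (fracE (mkB c w)) => [c' w'] /= /mkfracP /= e2.
apply/mkfracP; rewrite /= (ecA1 (val z)) (ecA1 (val z')).
rewrite -(ecA3 (val w)) -e2 -(ecA1 (val z)) -e1.
by rewrite (ecA1 (val z')) (ecA3 (val w')).
Qed.

Lemma scale_algfracE u z (b : B) w :
  (mk u z : fracfield) *: (mkB b w : algfrac) =
  mkB (gmul u b) (denommul hB z w).
Proof. exact: fracscaleE. Qed.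

Lemma algfrac_mulDl p q r :
  algfrac_mul (p + q) r = algfrac_mul p r + algfrac_mul q r.
Proof.
have [b [c [z [-> ->]]]] := common_denom p q; elim/fracW: r => d w.
by rewrite -mkfracDl !algfrac_mulE gmulDl mkfracDl.
Qed.

Lemma algfrac_mulDr p q r :
  algfrac_mul r (p + q) = algfrac_mul r p + algfrac_mul r q.
Proof.
have [b [c [z [-> ->]]]] := common_denom p q; elim/fracW: r => d w.
by rewrite -mkfracDl !algfrac_mulE gmulDr mkfracDl.
Qed.

Lemma algfrac_mul_linear_l q : linear (fun p => algfrac_mul p q).
Proof.
move=> a p r; rewrite algfrac_mulDl; congr (_ + _).
elim/fracW: a => u z; elim/fracW: p => b w; elim/fracW: q => c x.
rewrite scale_algfracE !algfrac_mulE scale_algfracE (ecA1 u).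
by congr mkfrac; apply: val_inj; rewrite /= ecmulA.
Qed.

Lemma algfrac_mul_linear_r q : linear (algfrac_mul q).
Proof.
move=> a p r; rewrite algfrac_mulDr; congr (_ + _).
elim/fracW: a => u z; elim/fracW: p => b w; elim/fracW: q => c x.
rewrite scale_algfracE !algfrac_mulE scale_algfracE (ecA3 u).
by congr mkfrac; apply: val_inj; rewrite /= -!ecmulA (ecmulC (val x)).
Qed.

Lemma gpart_ec i (u : evenCenter B) (b : B) : gpart i b -> gpart i (gmul u b).
Proof.
move=> hb; have hu : gpart false (u : B) by case: u => u /= /asboolP[].
exact: (gpart_mul hu hb).
Qed.

Lemma gpartD i (b c : B) : gpart i b -> gpart i c -> gpart i (b + c).
Proof. by move=> hb hc; have := gpartP 1 hb hc; rewrite scale1r. Qed.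

Lemma algfrac_part0 i : algfrac_part i 0.
Proof. by exists 0, (denom0 hB); split; [exact: gpart0|rewrite mkfrac0]. Qed.

Lemma algfrac_partP i (a : fracfield) p q :
  algfrac_part i p -> algfrac_part i q -> algfrac_part i (a *: p + q).
Proof.
move=> [b [z [hb ->]]] [c [w [hc ->]]]; elim/fracW: a => u x.
rewrite scale_algfracE mkfracD; eexists _, _; split; last by [].
by apply: gpartD => /=; [apply/gpart_ec/gpart_ec|apply: (gpart_ec (ecmul _ _))].
Qed.

Lemma algfrac_span p : exists p0 p1,
  [/\ algfrac_part false p0, algfrac_part true p1 & p = p0 + p1].
Proof.
elim/fracW: p => b z; have [b0 [b1 [h0 h1 ->]]] := gpart_span b.
exists (mkB b0 z), (mkB b1 z); split; first by exists b0, z.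
  by exists b1, z.
by rewrite -mkfracDl.
Qed.

Lemma algfrac_direct p : algfrac_part false p -> algfrac_part true p -> p = 0.
Proof.
move=> [b [z [hb ->]]] [c [w [hc /mkfracP /= e]]].
suff -> : b = 0 by rewrite mkfrac0.
apply: (alg_torsion_free hB (valP w)) => /=.
by apply: gpart_direct; [|rewrite e]; exact: gpart_ec.
Qed.

Lemma algfrac_part_mul i j p q : algfrac_part i p -> algfrac_part j q ->
  algfrac_part (i (+) j) (algfrac_mul p q).
Proof.
move=> [b [z [hb ->]]] [c [w [hc ->]]]; rewrite algfrac_mulE.
by eexists _, _; split; last by []; exact: gpart_mul.
Qed.

Definition central_closure : gralg fracfield :=
  GrAlg algfrac_mul_linear_l algfrac_mul_linear_r algfrac_part0 algfrac_partP
    algfrac_span algfrac_direct algfrac_part_mul.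
End FractionField.

Definition bilin (F : fieldType) (V : lmodType F) (m : V -> V -> V) : Prop :=
  (forall y, linear (fun x => m x y)) /\ (forall x, linear (m x)).

(* The graded algebra V + [V], the pair (x, y) standing for x + [y], with
   x . y = m00 x y,   [x] . [y] = m11 x y,
   x . [y] = [m01 x y],   [x] . y = [m10 x y]. *)
Section Double.
Variables (F : fieldType) (V : lmodType F) (m00 m11 m01 m10 : V -> V -> V).
Hypotheses (h00 : bilin m00) (h11 : bilin m11).
Hypotheses (h01 : bilin m01) (h10 : bilin m10).
Local Notation W := (V * V)%type.

Definition double_mul (p q : W) : W :=
  (m00 p.1 q.1 + m11 p.2 q.2, m01 p.1 q.2 + m10 p.2 q.1).
Definition double_part (i : bool) (p : W) : Prop :=
  if i then p.1 = 0 else p.2 = 0.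

Lemma double_linear_l q : linear (fun p => double_mul p q).
Proof.
move=> a p r; rewrite /double_mul /= (h00.1) (h11.1) (h01.1) (h10.1).
by congr pair; rewrite /= scalerDr addrACA.
Qed.

Lemma double_linear_r p : linear (double_mul p).
Proof.
move=> a q r; rewrite /double_mul /= (h00.2) (h11.2) (h01.2) (h10.2).
by congr pair; rewrite /= scalerDr addrACA.
Qed.

Lemma bilin0l m : bilin m -> forall y, m 0 y = 0 :> V.
Proof.
move=> [h _] y; apply: (addrI (m 0 y)).
by have := h y 1 0 0; rewrite !scale1r !addr0.
Qed.
Lemma bilin0r m : bilin m -> forall x, m x 0 = 0 :> V.
Proof.
move=> [_ h] x; apply: (addrI (m x 0)).
by have := h x 1 0 0; rewrite !scale1r !addr0.
Qed.

Lemma double_part0 i : double_part i 0.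
Proof. by case: i. Qed.
Lemma double_partP i a p q :
  double_part i p -> double_part i q -> double_part i (a *: p + q).
Proof. by case: i => /= -> ->; rewrite scaler0 addr0. Qed.
Lemma double_span p : exists p0 p1,
  [/\ double_part false p0, double_part true p1 & p = p0 + p1].
Proof.
case: p => x y; exists (x, 0), (0, y); split=> //.
by congr pair; rewrite /= ?addr0 ?add0r.
Qed.
Lemma double_direct p : double_part false p -> double_part true p -> p = 0.
Proof. by case: p => x y /= -> ->. Qed.
Lemma double_part_mul i j p q : double_part i p -> double_part j q ->
  double_part (i (+) j) (double_mul p q).
Proof.
by case: i; case: j => /= -> ->;
  rewrite ?(bilin0l h00) ?(bilin0l h11) ?(bilin0l h01) ?(bilin0l h10)
    ?(bilin0r h00) ?(bilin0r h11) ?(bilin0r h01) ?(bilin0r h10) addr0.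
Qed.

Definition double : gralg F :=
  GrAlg double_linear_l double_linear_r double_part0 double_partP
    double_span double_direct double_part_mul.
End Double.

Section Targets.
Variable F : fieldType.

Section Bnn.
Variable n : nat.
Implicit Types x y : 'rV[F]_n.

Definition rmul x y : 'rV[F]_n := \row_i (x 0 i * y 0 i).
(* (a_1, ..., a_n) |-> (a_2, ..., a_n, a_1) *)
Definition shift x : 'rV[F]_n := \row_i x 0 (ordS i).

Definition Bnn_oe x y := rmul x (shift y).

Lemma rmul_bilin : bilin rmul.
Proof.
by split=> [y a x z|x a y z]; apply/rowP => i; rewrite !mxE; ring.
Qed.
Lemma Bnn_oe_bilin : bilin Bnn_oe.
Proof.
by split=> [y a x z|x a y z]; apply/rowP => i; rewrite !mxE; ring.
Qed.

Definition Bnn : gralg F :=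
  double rmul_bilin rmul_bilin rmul_bilin Bnn_oe_bilin.
End Bnn.

Section B22.
Variable nu : F.
Implicit Types x y : 'rV[F]_2.

Definition star x : 'rV[F]_2 := \row_i x 0 (rev_ord i).
Definition chi x : 'rV[F]_2 :=
  \row_i (if i == 0 then x 0 0 + x 0 1 else x 0 0 + nu * x 0 1).

Definition B22_oo x y := rmul x (chi y).
Definition B22_oe x y := rmul x (star y).

Lemma B22_oo_bilin : bilin B22_oo.
Proof.
by split=> [y a x z|x a y z]; apply/rowP => i; rewrite !mxE;
  case: ifP => _; ring.
Qed.
Lemma B22_oe_bilin : bilin B22_oe.
Proof.
by split=> [y a x z|x a y z]; apply/rowP => i; rewrite !mxE; ring.
Qed.

Definition B22 : gralg F :=
  double (rmul_bilin 2) B22_oo_bilin (rmul_bilin 2) B22_oe_bilin.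
End B22.

Section B44.
(* Only meaningful when \tr w != 0 *)
Variable w : 'M[F]_2.
Implicit Types x y a : 'M[F]_2.

Definition Dw a : 'M[F]_2 := a *m w - w *m a.
Definition sympl a : 'M[F]_2 := (\tr a)%:M - a.

Definition B44_ee x y := x *m y.
Definition B44_oo x y := (\tr y / \tr w) *: x.
Definition B44_eo x y := x *m y - Dw (B44_oo x y).
Definition B44_oe x y := x *m sympl y.

Lemma B44_ee_bilin : bilin B44_ee.
Proof.
split=> [y a x z|x a y z]; rewrite /B44_ee.
  by rewrite mulmxDl -scalemxAl.
by rewrite mulmxDr -scalemxAr.
Qed.
Lemma B44_oo_bilin : bilin B44_oo.
Proof.
split=> [y a x z|x a y z]; rewrite /B44_oo.
  by rewrite scalerDr !scalerA mulrC.
by rewrite mxtraceD mxtraceZ scalerA -scalerDl mulrDl mulrA.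
Qed.
Lemma Dw_linear : linear Dw.
Proof.
move=> a x y; rewrite /Dw mulmxDl mulmxDr -scalemxAl -scalemxAr scalerBr.
by rewrite opprD addrACA.
Qed.
Lemma sympl_linear : linear sympl.
Proof.
move=> a x y; rewrite /sympl mxtraceD mxtraceZ raddfD /= scalerBr.
by rewrite scale_scalar_mx opprD addrACA.
Qed.
Lemma B44_eo_bilin : bilin B44_eo.
Proof.
split=> [y a x z|x a y z]; rewrite /B44_eo.
  rewrite (B44_oo_bilin.1 y a x z : B44_oo (a *: x + z) y = _) Dw_linear.
  by rewrite mulmxDl -scalemxAl [in RHS]scalerBr opprD addrACA.
rewrite (B44_oo_bilin.2 x a y z : B44_oo x (a *: y + z) = _) Dw_linear.
by rewrite mulmxDr -scalemxAr [in RHS]scalerBr opprD addrACA.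
Qed.
Lemma B44_oe_bilin : bilin B44_oe.
Proof.
split=> [y a x z|x a y z]; rewrite /B44_oe.
  by rewrite mulmxDl -scalemxAl.
by rewrite sympl_linear mulmxDr -scalemxAr.
Qed.

Definition B44 : gralg F :=
  double B44_ee_bilin B44_oo_bilin B44_eo_bilin B44_oe_bilin.
End B44.
End Targets.

(* Main.v *)
(* Let D be the target algebra and F = Z^-1 Z.  Call an operator T on D bounded if
   u T(B) is contained in B for some nonzero u in Z.  Bounded operators are closed
   under sums and composition, and contain all one-sided multiplications and the
   projections to the even and odd parts.  If lam is an F-linear functional on D
   such that x |-> lam(x) 1 is bounded, then u lam maps B into F1 \cap B = Z, so a
   finite separating family of such functionals embeds B in a power of Z.
   Coordinates are such functionals.  On the even part, x |-> x_ij 1 is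
   \sum_k e_ki x e_jk for matrices, while on F^n it is a combination of idempotents
   and of the cyclic shift, which is y |-> [1] . y followed by [y] |-> y.  The odd
   part is carried to the even part by right multiplication by [c], where c = w, 1
   and (1, 0) for B_{4|4}(w), B_{n|n} and B_{2|2}(nu) respectively. *)
Require Import Defs.
From mathcomp Require Import all_boot all_order all_algebra.
From HB Require Import structures.
From mathcomp Require Import boolp.

Import GRing.Theory.
Local Open Scope ring_scope.

Set Implicit Arguments.
Unset Strict Implicit.
Unset Printing Implicit Defensive.

(** * Matrix units and iterates of the cyclic shift *)

Lemma mul_delta_mx_delta (R : comNzRingType) m n p q (k : 'I_p) (i : 'I_m)
    (A : 'M[R]_(m, n)) (j : 'I_n) (l : 'I_q) :
  delta_mx k i *m A *m delta_mx j l = A i j *: delta_mx k l.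
Proof.
(* Each matrix unit is split as a column times a row, which leaves a 1 x 1 matrix with entry [A i j]
   in the middle. *)
rewrite -(mul_delta_mx (0 : 'I_1) k i) -(mul_delta_mx (0 : 'I_1) j l).
rewrite -(mulmxA (delta_mx k 0)) -rowE mulmxA -(mulmxA (delta_mx k 0)) -colE.
by rewrite [col _ _]mx11_scalar !mxE mul_mx_scalar -scalemxAl mul_delta_mx.
Qed.

(** The exponent stands for i - k modulo n; the extra n keeps the truncated subtraction exact. *)
Lemma iter_ordS_reach n (k i : 'I_n) : iter (i + n - k)%N (@ordS n) k = i.
Proof.
have val_iter j : iter j (@ordS n) k = ((k + j) %% n)%N :> nat.
  elim: j => [|j IH]; first by rewrite addn0 modn_small.
  by rewrite /= IH -addn1 modnDml addn1 addnS.
apply: val_inj; rewrite /= val_iter subnKC ?modnDr ?modn_small //.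
by rewrite (leq_trans (ltnW (ltn_ord k))) ?leq_addl.
Qed.

(** * Powers and unitization of Z as finitely generated Z-modules *)

Section CenterModules.
Variables (K : comNzRingType) (B : gralg K).

(** Scalars of K are absorbed into Z, so compatibility with Z will yield compatibility with K. *)
Lemma ecmul_gmul (u : evenCenter B) (k : K) (b : B) :
  gmul u (k *: b) = gmul (k *: u : evenCenter B) b.
Proof. by rewrite /= gmulZr gmulZl. Qed.

Section Power.
Variables (I : finType) (N : centerModule B).

Definition zpow_act (u : evenCenter B) (n : {ffun I -> N}) : {ffun I -> N} :=
  [ffun i => zact u (n i)].

Lemma zpow_act_linear_l n : linear (fun u => zpow_act u n).
Proof. by move=> a u v; apply/ffunP => i; rewrite !ffunE zact_linear_l. Qed.

Lemma zpow_act_linear_r u : linear (zpow_act u).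
Proof. by move=> a m n; apply/ffunP => i; rewrite !ffunE zact_linear_r. Qed.

Lemma zpow_actA u v n : zpow_act (ecmul u v) n = zpow_act u (zpow_act v n).
Proof. by apply/ffunP => i; rewrite !ffunE zactA. Qed.

Definition zpow : centerModule B :=
  ZModule zpow_act_linear_l zpow_act_linear_r zpow_actA.

Lemma zpow_zunital : zunital N -> zunital zpow.
Proof. by move=> hN e he n; apply/ffunP => i; rewrite ffunE hN. Qed.

(** The generators are the copies of the cyclic generator [v] placed in a single coordinate. *)
Lemma zpow_zfingen (v : N) :
  (forall n : N, exists (c : K) (u : evenCenter B), n = c *: v + zact u v) ->
  zfingen zpow.
Proof.
move=> hv; exists #|I|.
exists (fun j => [ffun i => if i == enum_val j then v else 0]) => n.
have /choice[c hc] : forall i, exists c : K, exists u : evenCenter B,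
  n i = c *: v + zact u v by move=> i; exact: hv.
have /choice[u hu] := hc.
exists (c \o enum_val), (u \o enum_val).
apply/ffunP => i; rewrite sum_ffunE (bigD1 (enum_rank i)) //= big1 => [|j ji].
  by rewrite !ffunE enum_rankK eqxx addr0.
rewrite !ffunE ifN ?scaler0 ?zact0r ?addr0 //.
by apply: contraNneq ji => ->; rewrite enum_valK.
Qed.
End Power.

(* The action of Z on its unitization K x Z, which is cyclic on (1, 0). *)
Definition unitz_act (u : evenCenter B) (p : K^o * evenCenter B) :
  K^o * evenCenter B := (0, (p.1 : K) *: u + ecmul u p.2).

Lemma unitz_act_linear_l p : linear (fun u => unitz_act u p).
Proof.
move=> a u v; congr pair => /=; first by rewrite scaler0 addr0.
rewrite ecmul_linear_l !scalerDr !scalerA (mulrC a).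
by rewrite -!addrA; congr (_ + _); rewrite addrCA.
Qed.

Lemma unitz_act_linear_r u : linear (unitz_act u).
Proof.
move=> a p q; congr pair => /=; first by rewrite scaler0 addr0.
rewrite ecmul_linear_r scalerDl -scalerA [in RHS]scalerDr.
by rewrite -!addrA; congr (_ + _); rewrite addrCA.
Qed.

Lemma unitz_actA u v p : unitz_act (ecmul u v) p = unitz_act u (unitz_act v p).
Proof.
by congr pair; rewrite /= scale0r add0r ecmulA ecmul_linear_r.
Qed.

Definition unitz : centerModule B :=
  ZModule unitz_act_linear_l unitz_act_linear_r unitz_actA.

Lemma zpow_embeds (I : finType) (M N : centerModule B) :
  zembeds M N -> zembeds (zpow I M) (zpow I N).
Proof.
move=> [f [finj fact]].
pose g (m : zpow I M) : zpow I N := [ffun i => f (m i)].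
have glin : linear g by move=> a m n; apply/ffunP => i; rewrite !ffunE linearP.
pose g' : {linear zpow I M -> zpow I N} :=
  HB.pack g (GRing.isLinear.Build _ _ _ _ g glin).
exists g'; split=> [m n /ffunP e|u m].
  by apply/ffunP => i; have := e i; rewrite !ffunE; exact: finj.
by apply/ffunP => i; rewrite !ffunE fact.
Qed.

Lemma zembeds_trans (L M N : centerModule B) :
  zembeds L M -> zembeds M N -> zembeds L N.
Proof.
move=> [f [finj fact]] [g [ginj gact]]; exists (g \o f); split.
  exact: inj_comp.
by move=> u m; rewrite /= fact gact.
Qed.

(* If Z has a unit then Z itself is cyclic; otherwise unitality is vacuous and
   the unitization of Z will do. *)
Lemma zpow_center_zfingen (I : finType) : exists N : centerModule B,
  [/\ zunital N, zfingen N & zembeds (zpow I (center_centerModule B)) N].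
Proof.
have [[e he]|ne] := pselect (exists e, forall u : evenCenter B, ecmul e u = u).
  exists (zpow I (center_centerModule B)); split.
  - by apply: zpow_zunital => e' he' n; exact: he'.
  - apply: (@zpow_zfingen I (center_centerModule B) e) => n; exists 0, n.
    by rewrite scale0r add0r /= ecmulC he.
  - by exists idfun; split=> // x y.
exists (zpow I unitz); split.
- by apply: zpow_zunital => e he; case: ne; exists e.
- apply: (@zpow_zfingen I unitz ((1 : K), 0)) => -[c u]; exists c, u.
  congr pair; rewrite /= ?addr0 ?scaler0 ?add0r ?scale1r.
    by rewrite [RHS]mulr1.
  rewrite -[LHS]addr0; congr (_ + _); apply: esym.
  exact: (zact0r (center_centerModule B) _).
- apply: zpow_embeds.
  pose g (u : evenCenter B) : K^o * evenCenter B := (0, u).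
  have glin : linear g by move=> a u v; congr pair; rewrite /= scaler0 addr0.
  pose g' : {linear center_centerModule B -> unitz} :=
    HB.pack g (GRing.isLinear.Build _ _ _ _ g glin).
  exists g'; split=> [u v []//|u v].
  by congr pair; rewrite /= scale0r add0r.
Qed.

(** * Division by nonzero elements of Z *)

Section Division.
Hypothesis hZ : regular_even_center B.

Lemma ec_gmulI (u : evenCenter B) (x y : B) :
  u != 0 -> gmul u x = gmul u y -> x = y.
Proof. exact: (zactI (alg_torsion_free hZ)). Qed.

(** Multiplication by [u] is injective and passes through all products, so each identity for [b] may
    be checked after replacing [b] by u b = v, which is central. *)
Lemma even_center_div (u v : evenCenter B) (b : B) :
  u != 0 -> gmul u b = v -> b \in @even_center _ B.
Proof.
move=> u0 e; apply/asboolP; split.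
  have [b0 [b1 [h0 h1 eb]]] := gpart_span b.
  suff b10 : b1 = 0 by rewrite eb b10 addr0.
  apply: (ec_gmulI u0); rewrite gmul0r.
  (* The element u b1 is odd, and being v - u b0 it is also even. *)
  apply: gpart_direct; last exact: gpart_ec.
  have -> : gmul u b1 = -1 *: gmul u b0 + ec_val v.
    by rewrite -e eb gmulDr scaleN1r addKr.
  apply: gpartP; first exact: gpart_ec.
  by case: (v) => ? /= /asboolP[].
apply/centerE => x y; split; apply: (ec_gmulI u0).
- by rewrite -(ecA1 u (gmul b x) y) -(ecA1 u b x) -(ecA1 u b) e (ecA1 v).
- rewrite -(ecA3 u x (gmul b y)) -(ecA1 u b y) e.
  by rewrite -(ecA1 u _ y) -(ecA3 u x b) e ecA2.
- rewrite -(ecA3 u (gmul x y) b) e -(ecA3 u x (gmul y b)) -(ecA3 u y b) e.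
  by rewrite !(ecC v) (ecA3 v).
- by rewrite -(ecA3 u x b) -(ecA1 u b x) e (ecC v).
Qed.
End Division.
End CenterModules.

(** * Modules inside their modules of fractions *)

Section Embedding.
Variables (K : comNzRingType) (B : gralg K) (hZ : regular_even_center B).
Local Notation F := (fracfield hZ).

Section Iota.
Variables (N : centerModule B) (tf : torsion_free N).
Local Notation z0 := (denom0 hZ).

(** The canonical map n |-> n/1, written with z0 n / z0 because Z need not contain a unit. *)
Definition iota (n : N) : fractions hZ tf := mkfrac hZ tf (zact (val z0) n) z0.

Lemma iotaD n m : iota (n + m) = iota n + iota m.
Proof. by rewrite /iota zactDr mkfracDl. Qed.

Lemma iota_inj : injective iota.
Proof. by move=> n m /mkfracP /(zactI tf (valP z0)) /(zactI tf (valP z0)). Qed.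
End Iota.

Local Notation iF := (@iota _ (center_torsion_free hZ) : evenCenter B -> F).

Lemma iotaZ (N : centerModule B) (tf : torsion_free N) u (n : N) :
  iF u *: iota tf n = iota tf (zact u n) :> fractions hZ tf.
Proof.
rewrite [LHS]fracscaleE; apply/mkfracP; rewrite /= !zactA.
by rewrite (zactC u).
Qed.

Lemma iota_mkfrac (N : centerModule B) (tf : torsion_free N) (n : N) z :
  iF (val z) *: mkfrac hZ tf n z = iota tf n :> fractions hZ tf.
Proof.
rewrite [LHS]fracscaleE; apply/mkfracP; rewrite /= !zactA.
by rewrite (zactC (val z)).
Qed.

Lemma iF_neq0 (u : evenCenter B) : u != 0 -> iF u != 0.
Proof.
apply: contraNneq => e; apply/eqP.
apply: (@iota_inj _ (center_torsion_free hZ)); rewrite e /iota.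
by rewrite (zact0r (center_centerModule B) _) mkfrac0.
Qed.

Lemma iF_mul (u v : evenCenter B) : iF (ecmul u v) = iF u * iF v.
Proof. by rewrite -(iotaZ (center_torsion_free hZ)). Qed.

(** * The image of B in the target algebra, and bounded operators *)

Section Target.
Variables (D : gralg F) (f : {linear central_closure hZ -> D}).
Hypotheses (fbij : bijective f)
  (fM : forall x y, f (gmul x y) = gmul (f x) (f y))
  (f_part : forall i x, gpart i x <-> gpart i (f x)).

Definition embB (b : B) : D := f (iota (alg_torsion_free hZ) b).
Local Notation J := embB.

Lemma embD x y : J (x + y) = J x + J y.
Proof. by rewrite /J iotaD linearD. Qed.

Lemma emb_inj : injective J.
Proof. by move=> x y /(bij_inj fbij) /iota_inj. Qed.

Lemma embZ u b : iF u *: J b = J (gmul u b).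
Proof. by rewrite /J -linearZ /= iotaZ. Qed.

Lemma embM x y : J (gmul x y) = gmul (J x) (J y).
Proof.
rewrite /J -fM; congr (f _); rewrite [RHS]algfrac_mulE.
apply/mkfracP; rewrite /= (ecA1 (val (denom0 hZ)) x) (ecA3 (val (denom0 hZ)) x).
by rewrite (ecA1 (val (denom0 hZ)) (val (denom0 hZ))).
Qed.

Lemma emb_part i b : gpart i b -> gpart i (J b).
Proof.
by move=> hb; apply/f_part; eexists _, _; split; last by []; exact: gpart_ec.
Qed.

Lemma emb_span (d : D) : exists u b, u != 0 /\ iF u *: d = J b.
Proof.
have [g fK gK] := fbij; rewrite -(gK d).
elim/fracW: (g d) => b z; exists (val z), b; split; first exact: (valP z).
by rewrite -linearZ /= iota_mkfrac.
Qed.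

Variable one : D.
Hypothesis gmul_one : forall x : D, gmul x one = x.

(** Left multiplication by J u is scaling by u on J(B), hence on all of D after clearing
    denominators; it is then evaluated at the right unit. *)
Lemma emb_ec (u : evenCenter B) : J u = iF u *: one.
Proof.
have h (x : D) : gmul (J u) x = iF u *: x.
  have [v [b [v0 e]]] := emb_span x.
  apply: (scalerI (iF_neq0 v0)).
  by rewrite -gmulZr e -embM -embZ -e !scalerA mulrC.
by rewrite -h gmul_one.
Qed.

(** If b = (u/z) 1 then z b = u lies in Z, and division by z stays in Z. *)
Lemma emb_scalar b (c : F) : J b = c *: one -> b \in @even_center _ B.
Proof.
elim/fracW: c => u z e; apply: (even_center_div hZ (valP z) (v := u)).
apply: emb_inj; rewrite -embZ e emb_ec scalerA.
by congr (_ *: _); exact: (iota_mkfrac (center_torsion_free hZ)).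
Qed.

(** Homogeneity is included so that, in a composite, the denominator of the inner operator can be
    moved through the outer one. *)
Definition bounded_denom (T : D -> D) : Prop :=
  (forall a, {morph T : x / a *: x}) /\
  exists u, u != 0 /\ forall b, exists b', iF u *: T (J b) = J b'.

Lemma bounded_comp S T :
  bounded_denom S -> bounded_denom T -> bounded_denom (S \o T).
Proof.
move=> [Sh [u [u0 hS]]] [Th [v [v0 hT]]]; split.
  by move=> a x; rewrite /= Th Sh.
exists (ecmul u v); split.
  by apply: contra_neq v0 => /(center_torsion_free hZ u0).
move=> b; have [b1 e1] := hT b; have [b2 e2] := hS b1; exists b2.
by rewrite -e2 -e1 Sh scalerA iF_mul.
Qed.

Lemma bounded_add S T : bounded_denom S -> bounded_denom T ->
  bounded_denom (fun x => S x + T x).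
Proof.
move=> [Sh [u [u0 hS]]] [Th [v [v0 hT]]]; split.
  by move=> a x; rewrite /= Th Sh scalerDr.
exists (ecmul u v); split.
  by apply: contra_neq v0 => /(center_torsion_free hZ u0).
move=> b; have [b1 e1] := hS b; have [b2 e2] := hT b.
exists (gmul v b1 + gmul u b2).
rewrite embD -!embZ -e1 -e2 scalerDr !scalerA iF_mul.
by rewrite (mulrC (iF v)).
Qed.

Lemma bounded_sum (I : finType) (T : I -> D -> D) :
  (forall i, bounded_denom (T i)) -> bounded_denom (fun x => \sum_i T i x).
Proof.
move=> hT; elim: (index_enum I) => [|i s IH].
  split=> [a x|]; first by rewrite !big_nil scaler0.
  exists (val (denom0 hZ)); split=> [|b]; first exact: (valP (denom0 hZ)).
  exists 0; rewrite big_nil scaler0; apply: (addrI (J 0)).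
  by rewrite -embD !addr0.
have -> : (fun x => \sum_(i <- i :: s) T i x) =
    (fun x => T i x + \sum_(i <- s) T i x).
  by apply/funext => x; rewrite big_cons.
exact: bounded_add.
Qed.

(** A denominator of [d] serves for all [b] at once. *)
Lemma bounded_mull d : bounded_denom (gmul d).
Proof.
split=> [a x|]; first exact: gmulZr.
have [u [c [u0 e]]] := emb_span d.
by exists u; split=> // b; exists (gmul c b); rewrite -gmulZl e embM.
Qed.

Lemma bounded_mulr d : bounded_denom (fun x => gmul x d).
Proof.
split=> [a x|]; first exact: gmulZl.
have [u [c [u0 e]]] := emb_span d.
by exists u; split=> // b; exists (gmul b c); rewrite -gmulZr e embM.
Qed.

Lemma gpart_uniq i (x y x' y' : D) : gpart i x -> gpart (~~ i) y ->
  gpart i x' -> gpart (~~ i) y' -> x + y = x' + y' -> x = x'.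
Proof.
move=> hx hy hx' hy' e; apply/eqP; rewrite -subr_eq0; apply/eqP.
have h : gpart i (x - x') by rewrite addrC -scaleN1r; exact: gpartP.
have h' : gpart (~~ i) (x - x').
  have -> : x - x' = -1 *: y + y'.
    by apply: (addIr x'); rewrite subrK scaleN1r -addrA (addrC y') -e addrC addrK.
  exact: gpartP.
by case: (i) h h' => /= h h'; apply: gpart_direct.
Qed.

(** The parity conditions determine P x, and the grading of B already supplies this component of J
    b, so any nonzero denominator will do. *)
Lemma bounded_proj i (P : D -> D) : (forall a, {morph P : x / a *: x}) ->
  (forall x, gpart i (P x)) -> (forall x, gpart (~~ i) (x - P x)) ->
  bounded_denom P.
Proof.
move=> Ph Pi Pn; split=> //; exists (val (denom0 hZ)).
split=> [|b]; first exact: (valP (denom0 hZ)).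
have [b0 [b1 [h0 h1 e]]] : exists b0 b1 : B,
    [/\ gpart i b0, gpart (~~ i) b1 & b = b0 + b1].
  have [b0 [b1 [h0 h1 e]]] := gpart_span b.
  by case: (i); [exists b1, b0; rewrite addrC|exists b0, b1].
exists (gmul (val (denom0 hZ)) b0); rewrite -embZ; congr (_ *: _).
apply: (gpart_uniq (Pi _) (Pn (J b)) (emb_part h0) (emb_part h1)).
by rewrite -embD -e addrC subrK.
Qed.

(* Clearing denominators, lam i maps B into F1 \cap B = Z. *)
Lemma zembeds_functionals (I : finType) (lam : I -> D -> F) :
  (forall i, scalar (lam i)) ->
  (forall i, bounded_denom (fun x => lam i x *: one)) ->
  (forall x, (forall i, lam i x = 0) -> x = 0) ->
  exists N : centerModule B,
    [/\ zunital N, zfingen N & zembeds (alg_centerModule B) N].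
Proof.
move=> lin bd sep.
have lamZ i a x : lam i (a *: x) = a * lam i x.
  have l0 : lam i 0 = 0.
    by apply: (addrI (lam i 0)); have := lin i 1 0 0; rewrite scale1r mul1r !addr0.
  by have := lin i a x 0; rewrite l0 !addr0.
have lamD i x y : lam i (x + y) = lam i x + lam i y.
  by have := lin i 1 x y; rewrite scale1r mul1r.
have /choice[r hr] : forall i, exists u : evenCenter B, u != 0 /\
    forall b, exists v : evenCenter B, (iF u * lam i (J b)) *: one = J v.
  move=> i; have [_ [u [u0 h]]] := bd i; exists u; split=> // b.
  have [b' e] := h b; rewrite scalerA in e.
  by exists (EvenCenter (emb_scalar (esym e))).
have r0 i : iF (r i) != 0 by apply: iF_neq0; have [] := hr i.
(* [phi] collects the maps r_i lam_i from B to Z. *)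
have /choice[phi phiE] : forall ib : I * B, exists v : evenCenter B,
    (iF (r ib.1) * lam ib.1 (J ib.2)) *: one = J v.
  by move=> ib; have [_] := hr ib.1; apply.
have Jval_inj (u v : evenCenter B) : J u = J v -> u = v.
  by move=> /emb_inj/val_inj.
have phiD i x y : phi (i, x + y) = phi (i, x) + phi (i, y).
  by apply: Jval_inj; rewrite embD -!phiE /= embD lamD mulrDr scalerDl.
have phiM i (u : evenCenter B) x : phi (i, gmul u x) = ecmul u (phi (i, x)).
  by apply: Jval_inj; rewrite /= -embZ -!phiE /= -embZ lamZ scalerA mulrCA.
have phiZ i k x : phi (i, k *: x) = k *: phi (i, x).
  (* The [lam i] are linear over F, not over K: multiplying by a nonzero element of Z lets it absorb
     [k], and [phiM] applies. *)
  apply: (zactI (center_torsion_free hZ) (valP (denom0 hZ))) => /=.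
  rewrite -phiM ecmul_gmul phiM; apply: val_inj.
  by rewrite /= gmulZl gmulZr.
have [N [N1 N2 N3]] := zpow_center_zfingen B I.
exists N; split=> //; apply: zembeds_trans N3.
pose g (b : alg_centerModule B) : zpow I (center_centerModule B) :=
  [ffun i => phi (i, b)].
have glin : linear g.
  by move=> a x y; apply/ffunP => i; rewrite !ffunE phiD phiZ.
pose g' : {linear alg_centerModule B -> zpow I (center_centerModule B)} :=
  HB.pack g (GRing.isLinear.Build _ _ _ _ g glin).
exists g'; split=> [x y /ffunP e|u b]; last first.
  by apply/ffunP => i; rewrite !ffunE phiM.
(* If [one] vanishes then D = 0; otherwise a scalar is determined by its multiple of [one]. *)
apply: emb_inj; have [one0|one0] := eqVneq one 0.
  by rewrite -(gmul_one (J x)) -(gmul_one (J y)) one0 !gmul0r.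
apply/eqP; rewrite -subr_eq0 -scaleN1r; apply/eqP; apply: sep => i.
rewrite lamD lamZ mulN1r; apply/eqP; rewrite subr_eq0; apply/eqP.
have := e i; rewrite !ffunE => /(congr1 (fun u : evenCenter B => J u)).
rewrite -!phiE /= => /eqP; rewrite -subr_eq0 -scalerBl scaler_eq0 (negPf one0).
by rewrite orbF subr_eq0 => /eqP /(mulfI (r0 i)).
Qed.
End Target.

(** * Targets of the form V + [V] *)

Section DoubleTarget.
Variables (V : lmodType F) (m00 m11 m01 m10 : V -> V -> V).
Hypotheses (h00 : bilin m00) (h11 : bilin m11).
Hypotheses (h01 : bilin m01) (h10 : bilin m10).
Local Notation D := (Defs.double h00 h11 h01 h10).
Variable f : {linear central_closure hZ -> D}.
Hypotheses (fbij : bijective f)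
  (fM : forall x y, f (gmul x y) = gmul (f x) (f y))
  (f_part : forall i x, gpart i x <-> gpart i (f x)).
Local Notation bounded := (@bounded_denom D f).

Definition even_op (T : V -> V) : D -> D := fun p => (T p.1, 0).

Lemma bounded_even_proj : bounded (even_op id).
Proof.
apply: (bounded_proj f_part (i := false)) => [a p|p|p] //=.
  by congr pair; rewrite /= scaler0.
by rewrite subrr.
Qed.

Lemma bounded_odd_proj : bounded (fun p : D => (0, p.2) : D).
Proof.
apply: (bounded_proj f_part (i := true)) => [a p|p|p] //=.
  by congr pair; rewrite /= scaler0.
by rewrite subrr.
Qed.

Lemma bounded_even_comp S T : bounded (even_op S) -> bounded (even_op T) ->
  bounded (even_op (S \o T)).
Proof. exact: bounded_comp. Qed.

Lemma bounded_even_sum (I : finType) (T : I -> V -> V) :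
  (forall i, bounded (even_op (T i))) ->
  bounded (even_op (fun x => \sum_i T i x)).
Proof.
move=> hT; have := bounded_sum hT.
congr bounded; apply/funext => p; apply: esym.
apply: (big_morph (fun y : V => (y, 0) : D)) => // x y.
by congr pair; rewrite /= addr0.
Qed.

Lemma bounded_even_mull a : bounded (even_op (m00 a)).
Proof.
have := bounded_comp (bounded_mull fbij fM ((a, 0) : D)) bounded_even_proj.
congr bounded; apply/funext => p; congr pair => /=.
  by rewrite (bilin0l h11) addr0.
by rewrite (bilin0r h01) (bilin0l h10) addr0.
Qed.

Lemma bounded_even_mulr a : bounded (even_op (m00^~ a)).
Proof.
have := bounded_comp (bounded_mulr fbij fM ((a, 0) : D)) bounded_even_proj.
congr bounded; apply/funext => p; congr pair => /=.
  by rewrite (bilin0l h11) addr0.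
by rewrite (bilin0r h01) (bilin0l h10) addr0.
Qed.

Section RightOdd.
Variable c : V.
Hypothesis m11c : forall y, m11 y c = y.

(** Right multiplication by [c] removes the bracket from [y]; projecting to the odd part first
    discards the even component. *)
Lemma bounded_odd_to_even : bounded (fun p : D => (p.2, 0) : D).
Proof.
have := bounded_comp (bounded_mulr fbij fM ((0, c) : D)) bounded_odd_proj.
congr bounded; apply/funext => p; congr pair => /=.
  by rewrite (bilin0l h00) add0r m11c.
by rewrite (bilin0l h01) (bilin0r h10) addr0.
Qed.

Lemma bounded_even_oe a : bounded (even_op (m10 a)).
Proof.
have := bounded_comp bounded_odd_to_even
  (bounded_comp (bounded_mull fbij fM ((0, a) : D)) bounded_even_proj).
congr bounded; apply/funext => p; congr pair => /=.
by rewrite (bilin0l h01) add0r.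
Qed.

(** Each coordinate on V gives two functionals on D, read on the even part and, after removing the
    bracket, on the odd part. *)
Lemma zembeds_double (e : V) (I : finType) (lam : I -> V -> F) :
  (forall x, m00 x e = x) -> (forall y, m10 y e = y) ->
  (forall i, scalar (lam i)) ->
  (forall x, (forall i, lam i x = 0) -> x = 0) ->
  (forall i, bounded (even_op (fun x => lam i x *: e))) ->
  exists N : centerModule B,
    [/\ zunital N, zfingen N & zembeds (alg_centerModule B) N].
Proof.
move=> m00e m10e lin sep bd.
pose lam2 (bi : bool * I) (p : D) := lam bi.2 (if bi.1 then p.2 else p.1).
apply: (zembeds_functionals fbij fM (one := (e, 0)) _ (lam := lam2)).
- move=> [x y]; congr pair => /=.
    by rewrite (bilin0r h11) addr0 m00e.
  by rewrite (bilin0r h01) add0r m10e.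
- by move=> [[] i] a p q; rewrite /lam2 /= lin.
- move=> [[] i]; [have := bounded_comp (bd i) bounded_odd_to_even|have := bd i];
    by congr bounded; apply/funext => p; congr pair; rewrite /= scaler0.
- move=> [x y] h; congr pair; apply: sep => i.
    exact: (h (false, i)).
  exact: (h (true, i)).
Qed.
End RightOdd.
End DoubleTarget.

(** * Coordinates on the three families of targets *)

Lemma zembeds_B44 (w : 'M[F]_2) : \tr w != 0 ->
  gr_iso (central_closure hZ) (B44 w) ->
  exists N : centerModule B,
    [/\ zunital N, zfingen N & zembeds (alg_centerModule B) N].
Proof.
move=> w0 [f [fbij fM f_part]].
have oow (y : 'M[F]_2) : B44_oo w y w = y by rewrite /B44_oo divff ?scale1r.
pose lam (ij : 'I_2 * 'I_2) (x : 'M[F]_2) : F := x ij.1 ij.2.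
apply: (zembeds_double fbij fM f_part oow (e := 1%:M) (lam := lam)).
- by move=> x; rewrite /B44_ee mulmx1.
(* The identity has trace 2, so its conjugate is 2 - 1 = 1. *)
- move=> y; rewrite /B44_oe; have -> : sympl 1%:M = 1%:M :> 'M[F]_2.
    by rewrite /sympl mxtrace1 -raddfB /= mulrSr addrK.
  exact: mulmx1.
- by move=> ij a x y; rewrite /lam !mxE.
- by move=> x h; apply/matrixP => i j; rewrite mxE; exact: (h (i, j)).
move=> [i j].
have := bounded_even_sum (fun k : 'I_2 => bounded_even_comp
  (bounded_even_mull fbij fM f_part (delta_mx k i))
  (bounded_even_mulr fbij fM f_part (delta_mx j k))).
congr (bounded_denom f); apply/funext => x.
congr pair; rewrite /lam mx1_sum_delta scaler_sumr.
by apply: eq_bigr => k _; rewrite /= /B44_ee mulmxA mul_delta_mx_delta.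
Qed.

Section Cyclic.
Variables (n : nat) (m11 m01 m10 : 'rV[F]_n -> 'rV[F]_n -> 'rV[F]_n).
Hypotheses (h11 : bilin m11) (h01 : bilin m01) (h10 : bilin m10).
Local Notation D := (Defs.double (rmul_bilin F n) h11 h01 h10).
Variable f : {linear central_closure hZ -> D}.
Hypotheses (fbij : bijective f)
  (fM : forall x y, f (gmul x y) = gmul (f x) (f y))
  (f_part : forall i x, gpart i x <-> gpart i (f x)).
Variable c : 'rV[F]_n.
Hypotheses (m11c : forall y, m11 y c = y)
  (m10_1 : forall y, m10 (const_mx 1) y = shift y)
  (m10_r1 : forall y, m10 y (const_mx 1) = y).

(** Common to B_{n|n} and B_{2|2}(nu): the even part is F^n, and multiplying by [1] on the left
    shifts coordinates cyclically. *)
Lemma zembeds_cyclic : exists N : centerModule B,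
  [/\ zunital N, zfingen N & zembeds (alg_centerModule B) N].
Proof.
pose lam (i : 'I_n) (x : 'rV[F]_n) : F := x 0 i.
apply: (zembeds_double fbij fM f_part m11c (e := const_mx 1) (lam := lam)).
- by move=> x; apply/rowP => i; rewrite !mxE mulr1.
- exact: m10_r1.
- by move=> i a x y; rewrite /lam !mxE.
- by move=> x h; apply/rowP => i; rewrite mxE; exact: h.
move=> i; pose E (k : 'I_n) := rmul (delta_mx 0 k : 'rV[F]_n).
pose sh j (x : 'rV[F]_n) := iter j (@shift F n) x.
have bsh j : bounded_denom f (even_op (sh j)).
  elim: j => [|j IH]; first exact: bounded_even_proj.
  have -> : sh j.+1 = m10 (const_mx 1) \o sh j.
    by apply/funext => x; rewrite /= m10_1.
  by apply: bounded_even_comp => //; exact: (bounded_even_oe fbij fM f_part m11c).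
(* With e_k the idempotents, e_i x = x_i e_i is shifted i - k times and cut down by e_k to x_i e_k;
   these sum to x_i 1. *)
have := bounded_even_sum (fun k : 'I_n => bounded_even_comp
  (bounded_even_mull fbij fM f_part (delta_mx 0 k))
  (bounded_even_comp (bsh (i + n - k)%N)
    (bounded_even_mull fbij fM f_part (delta_mx 0 i)))).
congr (bounded_denom f); apply/funext => x.
have shE j (y : 'rV[F]_n) k : sh j y 0 k = y 0 (iter j (@ordS n) k).
  by elim: j k => //= j IH k; rewrite mxE IH -iterSr.
congr pair; apply/rowP => p; rewrite summxE (bigD1 p) //= big1 => [|k kp].
  rewrite addr0 !mxE shE !mxE !eqxx mul1r mulr1.
  by rewrite iter_ordS_reach eqxx mul1r.
by rewrite !mxE eq_sym (negPf kp) andbF mul0r.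
Qed.
End Cyclic.

Lemma zembeds_Bnn n : gr_iso (central_closure hZ) (Bnn F n) ->
  exists N : centerModule B,
    [/\ zunital N, zfingen N & zembeds (alg_centerModule B) N].
Proof.
move=> [f [fbij fM f_part]].
apply: (zembeds_cyclic fbij fM f_part (c := const_mx 1)) => y;
  by apply/rowP => i; rewrite !mxE ?mulr1 ?mul1r.
Qed.

(** Here chi(1, 0) = (1, 1) whatever [nu] is, and on two coordinates the swap * is the cyclic
    shift. *)
Lemma zembeds_B22 nu : gr_iso (central_closure hZ) (B22 nu) ->
  exists N : centerModule B,
    [/\ zunital N, zfingen N & zembeds (alg_centerModule B) N].
Proof.
move=> [f [fbij fM f_part]].
apply: (zembeds_cyclic fbij fM f_part (c := delta_mx 0 0)) => y;
  apply/rowP => i; rewrite !mxE /= ?mulr1 ?mul1r //.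
  by rewrite mulr0 addr0 if_same mulr1.
by congr (y _ _); apply: val_inj; case: i => [[|[]]].
Qed.

End Embedding.

Theorem theorem2 (K : comNzRingType) (B : gralg K)
    (hB : right_alternative_super B) (hZ : regular_even_center B)
    (hord :
       (exists w : 'M[fracfield hZ]_2,
          \tr w != 0 /\ gr_iso (central_closure hZ) (B44 w)) \/
       (exists n : nat,
          (0 < n)%N /\ gr_iso (central_closure hZ) (Bnn (fracfield hZ) n)) \/
       (exists nu : fracfield hZ, gr_iso (central_closure hZ) (B22 nu))) :
  exists N : centerModule B,
    zunital N /\ zfingen N /\ zembeds (alg_centerModule B) N.
Proof.
suff [N [? ? ?]] : exists N : centerModule B,
  [/\ zunital N, zfingen N & zembeds (alg_centerModule B) N] by exists N.
case: hord => [[w [w0 h]]|[[n [_ h]]|[nu h]]].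
- exact: zembeds_B44 w0 h.
- exact: zembeds_Bnn h.
- exact: zembeds_B22 h.
Qed.
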